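(* $R_3(\mathcal{B}(K_4),2)=6$.
   Context: For a graph $G$, a hypergraph $H$ is a Berge-$G$ hypergraph if there are an injective map $\phi:V(G)\to V(H)$ and pairwise distinct hyperedges $e_{xy}\in E(H)$, one for each $xy\in E(G)$, with $\phi(x),\phi(y)\in e_{xy}$. $\mathcal{B}(G)$ denotes the family of all Berge-$G$ hypergraphs. For a family $\mathcal{H}$ of $3$-uniform hypergraphs, $R_3(\mathcal{H},k)$ is the smallest $n$ such that every $k$-coloring of the hyperedges of the complete $3$-uniform hypergraph $K_n^3$ contains a monochromatic subhypergraph belonging to $\mathcal{H}$. *)

(* Defs.v *)
From mathcomp Require Import all_boot.
Set Implicit Arguments. Unset Strict Implicit. Unset Printing Implicit Defensive.

(* A graph G is given by its vertex type V and its edge set EG, a set of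
   2-element subsets of V. A hypergraph H on vertex type T is given by its
   set of hyperedges H : {set {set T}}. *)

Definition is_berge (V T : finType) (EG : {set {set V}}) (H : {set {set T}}) : Prop :=
  exists (phi : V -> T) (e : {set V} -> {set T}),
    [/\ injective phi,
        {in EG &, injective e} &
        forall A, A \in EG -> e A \in H /\ (forall x, x \in A -> phi x \in e A)].

Definition K4_edges : {set {set 'I_4}} := [set A : {set 'I_4} | #|A| == 2].

Definition colour_class (n k : nat) (c : {set 'I_n} -> 'I_k) (i : 'I_k)
  : {set {set 'I_n}} := [set A : {set 'I_n} | (#|A| == 3) && (c A == i)].

(* Every k-colouring of the hyperedges of K_n^3 contains a monochromatic
   subhypergraph that is a Berge-G hypergraph. (Colourings are given as
   functions on all subsets; only values on 3-sets matter.) *)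
Definition ramsey3_prop (V : finType) (EG : {set {set V}}) (k n : nat) : Prop :=
  forall c : {set 'I_n} -> 'I_k, exists (i : 'I_k) (H : {set {set 'I_n}}),
    H \subset colour_class c i /\ is_berge EG H.

Definition ramsey3_is (V : finType) (EG : {set {set V}}) (k r : nat) : Prop :=
  ramsey3_prop EG k r /\ forall n, ramsey3_prop EG k n -> r <= n.

(* Main.v *)
(* Lower bound: a Berge-K_4 needs six hyperedges, and for n <= 5 the at most ten
   triples can be coloured with each colour used at most five times.
   Upper bound: colour the twenty triples on six points one at a time and give
   up a branch as soon as one colour contains a Berge-K_4, that is, as soon as
   the six pairs of some four points have distinct representatives among the
   triples of that colour containing them. Every branch dies, after fewer than
   2500 leaves. *)
Require Import Defs.
From mathcomp Require Import all_boot.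
Set Implicit Arguments. Unset Strict Implicit. Unset Printing Implicit Defensive.

Section DistinctRepresentatives.
Variables (P T : eqType) (cov : P -> T -> bool).

(** Backtracking search: removing the chosen [t] from [R] keeps later choices distinct. The inner
    conditional stops call-by-value evaluation from searching below a [t] that does not fit. *)
Fixpoint has_sdr (ps : seq P) (R : seq T) : bool :=
  if ps is p :: ps' then
    has (fun t => if cov p t then has_sdr ps' (rem t R) else false) R
  else true.

Lemma has_sdrP (t0 : T) (ps : seq P) (R : seq T) :
    uniq ps -> uniq R -> has_sdr ps R ->
  exists f : P -> T, {in ps &, injective f} /\
    (forall p, p \in ps -> f p \in R /\ cov p (f p)).
Proof.
elim: ps R => [|p ps IH] R /=; first by exists (fun=> t0).
move=> /andP[pNps ups] uR /hasP[t tR]; case: ifP => // cpt /IH.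
case/(_ ups (rem_uniq t uR)) => f [finj fP].
(* [R] has no repetitions, so [rem t R] has lost its only copy of [t], and [p] may be sent to
   [t]. *)
have fNt q : q \in ps -> f q != t.
  by move=> /fP[]; rewrite mem_rem_uniq // => /andP[].
have neq q : q \in ps -> (q == p) = false.
  by move=> qps; apply/eqP=> qp; rewrite -qp qps in pNps.
exists (fun q => if q == p then t else f q); split=> [q r|q].
  rewrite !inE => /predU1P[->|qps] /predU1P[->|rps] //; rewrite ?eqxx ?neq //.
  - by move=> tf; move: (fNt _ rps); rewrite -tf eqxx.
  - by move=> ft; move: (fNt _ qps); rewrite ft eqxx.
  - exact: finj.
rewrite inE => /predU1P[->|qps]; first by rewrite eqxx.
by rewrite neq //; have [/mem_rem] := fP q qps.
Qed.

End DistinctRepresentatives.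

(** Encodes the [k]-subsets of ['I_n] as bit sequences, so that the search computes on plain
    lists. *)
Fixpoint masks (n k : nat) : seq bitseq :=
  if n is n'.+1 then
    (if k is k'.+1 then [seq true :: m | m <- masks n' k'] else [::])
    ++ [seq false :: m | m <- masks n' k]
  else if k is 0 then [:: [::]] else [::].

Lemma mem_masks n k m :
  (m \in masks n k) = (size m == n) && (count id m == k).
Proof.
have mem_cons b b' x (s : seq bitseq) :
    (b :: x \in [seq b' :: y | y <- s]) = (b == b') && (x \in s).
  apply/mapP/andP=> [[y ys [-> ->]]|[/eqP -> xs]]; first by rewrite eqxx.
  by exists x.
have nil_cons b (s : seq bitseq) : ([::] \in [seq b :: x | x <- s]) = false.
  by apply/mapP=> -[].
elim: n k m => [|n IH] [|k] [|[] m] //=;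
  by rewrite ?mem_cat ?nil_cons ?mem_cons ?IH ?eqSS ?andbF ?orbF.
Qed.

Definition set_of_mask (n : nat) (m : bitseq) : {set 'I_n} :=
  [set i : 'I_n | nth false m i].

Definition mask_of_set (n : nat) (A : {set 'I_n}) : bitseq :=
  [seq i \in A | i <- enum 'I_n].

Lemma card_set_of_mask n m : size m = n -> #|set_of_mask n m| = count id m.
Proof.
move=> sm; rewrite cardsE cardE size_filter -[in RHS](mkseq_nth false m) sm.
by rewrite /mkseq count_map -val_enum_ord count_map enumT.
Qed.

(** The common length matters: [nth false] reads missing entries as [false], so masks differing in
    trailing [false] entries give the same set. *)
Lemma set_of_mask_inj n k : {in masks n k &, injective (set_of_mask n)}.
Proof.
move=> a b; rewrite !mem_masks => /andP[/eqP sa _] /andP[/eqP sb _] /setP ab.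
apply: (@eq_from_nth _ false); rewrite ?sb // sa => i ltin.
by have := ab (Ordinal ltin); rewrite !inE.
Qed.

Lemma nth_mask_of_set n (A : {set 'I_n}) (i : 'I_n) :
  nth false (mask_of_set A) i = (i \in A).
Proof. by rewrite (nth_map i) ?size_enum_ord // nth_ord_enum. Qed.

Lemma mask_of_set_inj n : injective (@mask_of_set n).
Proof.
by move=> A B AB; apply/setP=> i; rewrite -!nth_mask_of_set AB.
Qed.

Lemma mem_mask_of_set n (A : {set 'I_n}) : mask_of_set A \in masks n #|A|.
Proof.
rewrite mem_masks size_map size_enum_ord eqxx count_map cardE size_filter.
by rewrite -enumT eqxx.
Qed.

Lemma masks_uniq n k : uniq (masks n k).
Proof.
elim: n k => [|n IH] [|k] //=; rewrite ?map_inj_uniq ?IH //; try by move=> ? ? [].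
rewrite cat_uniq !map_inj_uniq ?IH //; try by move=> ? ? [].
by rewrite andbT; apply/hasPn=> _ /mapP[x _ ->]; apply/mapP=> -[].
Qed.

(** The 15 choices of four points out of six. One order for each is enough, as every permutation of
    the vertices preserves K_4. *)
Definition cores : seq (seq nat) := [seq mask m (iota 0 6) | m <- masks 6 4].

Lemma coresP s :
  s \in cores -> [/\ uniq s, size s = 4 & forall i, nth 0 s i < 6].
Proof.
case/mapP=> m; rewrite mem_masks => /andP[/eqP sm /eqP cm ->].
have sz : size (mask m (iota 0 6)) = 4 by rewrite size_mask ?size_iota.
split=> // [|i]; first by rewrite mask_uniq ?iota_uniq.
(* Past the end [nth] returns the default 0, which is also below 6. *)
have [lti|lei] := ltnP i (size (mask m (iota 0 6))); last by rewrite nth_default.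
by have := mem_mask (mem_nth 0 lti); rewrite mem_iota.
Qed.

(** The pair [p] lives on the vertices 0 to 3, the triple [t] on the six points; [s] sends each
    vertex to its point. *)
Definition covers (s : seq nat) (p t : bitseq) : bool :=
  all (fun i => nth false p i ==> nth false t (nth 0 s i)) (iota 0 4).

(** The size test is a shortcut: six pairs need six distinct triples. *)
Definition has_berge_K4 (R : seq bitseq) : bool :=
  if size R <= 5 then false
  else has (fun s => has_sdr (covers s) (masks 4 2) R) cores.

(** The list [s] places the vertices and the representatives [f] choose the hyperedges; translating
    between sets and masks loses no distinctness. *)
Lemma has_berge_K4P (R : seq bitseq) (H : {set {set 'I_6}}) :
    uniq R -> {subset R <= masks 6 3} ->
    (forall t, t \in R -> set_of_mask 6 t \in H) ->
  has_berge_K4 R -> is_berge K4_edges H.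
Proof.
move=> uR R3 RH; rewrite /has_berge_K4; case: ifP => // _ /hasP[s].
case/coresP=> us ss s6 /(has_sdrP [::] (masks_uniq 4 2) uR)[f [finj fP]].
have edge A : A \in K4_edges -> mask_of_set A \in masks 4 2.
  by rewrite inE => /eqP A2; have := mem_mask_of_set A; rewrite A2.
exists (fun i : 'I_4 => inord (nth 0 s i)).
exists (fun A => set_of_mask 6 (f (mask_of_set A))).
split.
- move=> i j /(congr1 (@nat_of_ord 6)); rewrite !inordK // => /eqP.
  by rewrite nth_uniq ?ss // => /eqP /val_inj.
- move=> A B /edge eA /edge eB fAB; apply: mask_of_set_inj.
  apply: (finj _ _ eA eB); apply: (@set_of_mask_inj 6 3) fAB.
    by apply/R3; have [] := fP _ eA.
  by apply/R3; have [] := fP _ eB.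
- move=> A /edge /fP[fR /allP cov]; split=> [|i iA]; first exact: RH.
  rewrite inE inordK //.
  by have := cov i; rewrite mem_iota ltn_ord nth_mask_of_set iA; apply.
Qed.

(* Nested conditionals, because [&&] and [||] would make the call-by-value
   [vm_compute] explore all 2^20 colourings. *)
Fixpoint mono_unavoidable (todo R B : seq bitseq) : bool :=
  if todo is t :: s then
    if (if has_berge_K4 (t :: R) then true else mono_unavoidable s (t :: R) B)
    then (if has_berge_K4 (t :: B) then true else mono_unavoidable s R (t :: B))
    else false
  else false.

(** The induction follows the one branch that [c] dictates: [R] and [B] collect the triples coloured
    [ord0] and [ord_max]. An exhausted list returns [false], so a successful search has met a
    Berge-K_4 before. *)
Lemma mono_unavoidableP (c : {set 'I_6} -> 'I_2) (todo R B : seq bitseq) :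
    uniq (todo ++ R) -> uniq (todo ++ B) ->
    {subset todo ++ R <= masks 6 3} -> {subset todo ++ B <= masks 6 3} ->
    (forall t, t \in R -> c (set_of_mask 6 t) = ord0) ->
    (forall t, t \in B -> c (set_of_mask 6 t) = ord_max) ->
  mono_unavoidable todo R B -> exists i, is_berge K4_edges (colour_class c i).
Proof.
have berge i S : uniq S -> {subset S <= masks 6 3} ->
    (forall t, t \in S -> c (set_of_mask 6 t) = i) -> has_berge_K4 S ->
  exists i, is_berge K4_edges (colour_class c i).
  move=> uS S3 cS bS; exists i; apply: has_berge_K4P bS => // t tS.
  rewrite inE cS // eqxx andbT; have := S3 t tS.
  by rewrite mem_masks => /andP[/eqP st /eqP ct]; rewrite card_set_of_mask ?ct.
(* [next] maintains the invariants for the list that receives [t], [tail] below for the other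
   one. *)
have next (s S : seq bitseq) t :
    uniq (t :: s ++ S) -> {subset t :: s ++ S <= masks 6 3} ->
  [/\ uniq (s ++ t :: S), {subset s ++ t :: S <= masks 6 3},
      uniq (t :: S) & {subset t :: S <= masks 6 3}].
  move=> u sub; have /permPl pe := perm_catCA s [:: t] S.
  have sub' : {subset s ++ t :: S <= masks 6 3}.
    by move=> x; rewrite (perm_mem pe); apply: sub.
  have u' : uniq (s ++ t :: S) by rewrite (perm_uniq pe).
  split=> //; first by move: u'; rewrite cat_uniq => /and3P[].
  by move=> x xS; apply: sub'; rewrite mem_cat xS orbT.
elim: todo R B => [//|t s IH] R B uR uB R3 B3 cR cB /=.
have [uR1 R31 uR2 R32] := next _ _ _ uR R3.
have [uB1 B31 uB2 B32] := next _ _ _ uB B3.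
have tail (S : seq bitseq) : uniq ((t :: s) ++ S) ->
    {subset (t :: s) ++ S <= masks 6 3} ->
    uniq (s ++ S) /\ {subset s ++ S <= masks 6 3}.
  move=> /= /andP[_ u] sub; split=> // x xs.
  by apply: sub; rewrite inE xs orbT.
have [[uR0 R0] [uB0 B0]] := (tail _ uR R3, tail _ uB B3).
have [ct|ct] : c (set_of_mask 6 t) = ord0 \/ c (set_of_mask 6 t) = ord_max.
- case: (c (set_of_mask 6 t)) => -[|[|k]] lt; [left|right|by []];
    exact: val_inj.
- have cR' u : u \in t :: R -> c (set_of_mask 6 u) = ord0.
    by rewrite inE => /predU1P[->|/cR].
  case: ifP => //; case: ifP => [bR _ _|_ rec _]; first exact: (berge ord0 _ uR2 R32 cR' bR).
  exact: (IH _ _ uR1 uB0 R31 B0 cR' cB rec).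
- have cB' u : u \in t :: B -> c (set_of_mask 6 u) = ord_max.
    by rewrite inE => /predU1P[->|/cB].
  case: ifP => // _; case: ifP => [bB _|_ rec]; first exact: (berge ord_max _ uB2 B32 cB' bB).
  exact: (IH _ _ uR0 uB1 R0 B31 cR cB' rec).
Qed.

Lemma mono_unavoidable6 : mono_unavoidable (masks 6 3) [::] [::].
Proof. by vm_compute. Qed.

Lemma ramsey3_K4_6 : ramsey3_prop K4_edges 2 6.
Proof.
move=> c.
have [||||||i ci] := mono_unavoidableP (c := c) _ _ _ _ _ _ mono_unavoidable6.
all: rewrite ?cats0 ?masks_uniq //.
by exists i, (colour_class c i).
Qed.

(** The 6 edges of K_4, two out of four vertices, are mapped injectively into [H]. *)
Lemma berge_K4_card (T : finType) (H : {set {set T}}) :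
  is_berge K4_edges H -> 6 <= #|H|.
Proof.
case=> [phi [e [_ einj eP]]].
have <- : #|e @: K4_edges| = 6.
  by rewrite (card_in_imset einj) card_draws card_ord.
by apply/subset_leq_card/subsetP=> _ /imsetP[A /eP[eH _] ->].
Qed.

Lemma ramsey3_K4_ge6 n : ramsey3_prop K4_edges 2 n -> 6 <= n.
Proof.
move=> ram; rewrite leqNgt; apply/negP=> n5.
pose D : {set {set 'I_n}} := [set A : {set 'I_n} | #|A| == 3].
have sD : size (enum D) <= 10.
  rewrite -cardE card_draws card_ord.
  (* Five points carry 10 triples. *)
  by apply: leq_trans (leq_bin2l 3 (n5 : n <= 5)) _.
(* The first five triples get one colour; at most five remain for the other. *)
pose c A : 'I_2 := if A \in take 5 (enum D) then ord0 else ord_max.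
have [i [H [/subset_leq_card Hc /berge_K4_card H6]]] := ram c.
have /leq_trans/(_ Hc) := H6; apply/negP; rewrite -leqNgt.
have short (s : seq {set 'I_n}) : size s <= 5 ->
    {subset colour_class c i <= s} -> #|colour_class c i| <= 5.
  move=> s5 /subsetP/subset_leq_card/leq_trans; apply.
  exact: leq_trans (card_size s) s5.
have inD A : A \in colour_class c i -> A \in take 5 (enum D) ++ drop 5 (enum D).
  by rewrite cat_take_drop mem_enum !inE => /andP[].
have [i0|iN0] := eqVneq i ord0.
  apply: (short (take 5 (enum D))) => [|A]; first by rewrite size_take_min geq_minl.
  by rewrite inE i0 /c => /andP[_]; case: ifP.
apply: (short (drop 5 (enum D))) => [|A Ac].
  by rewrite size_drop leq_subLR.
have := inD A Ac; rewrite mem_cat => /orP[At|//].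
(* A triple among the first five has colour [ord0], which differs from [i]. *)
by move: Ac; rewrite inE /c At [ord0 == i]eq_sym (negPf iN0) andbF.
Qed.

Theorem theorem4 : ramsey3_is K4_edges 2 6.
Proof. by split; [exact: ramsey3_K4_6 | exact: ramsey3_K4_ge6]. Qed.
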